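(* There exists $C>1$ such that for every positive integer $d$, if $G$ is an $(n,k,\lambda)$-graph with $k\ge\max\{9d\lambda,\,Cd\log d\}$, then $G$ admits a strong $d$-rigid partition.
   Context: An $(n,k,\lambda)$-graph is an $n$-vertex $k$-regular graph whose adjacency eigenvalues $\lambda_1\ge\lambda_2\ge\dots\ge\lambda_n$ satisfy $\max\{|\lambda_2|,|\lambda_n|\}\le\lambda$. For $A,B\subseteq V$, $G[A,B]$ is the graph on $A\cup B$ with the edges of $G$ having one endpoint in $A$ and the other in $B$. A strong $d$-rigid partition of $G$ is a partition $V=V_1\cup\dots\cup V_d$ into nonempty sets such that $G[V_i,V_j]$ is connected for all $1\le i\le j\le d$. Logarithms are natural.
   Formalization: The degree k is additionally assumed positive; without this the claim fails for d=1, since the edgeless graph on n≥2 vertices is an (n,0,0)-graph with k=0≥max{0,0} but is disconnected (for d≥2 positivity of k is automatic). *)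

(* Defs.v *)
From mathcomp Require Import all_boot all_order all_algebra.
From mathcomp Require Import reals exp.

Set Implicit Arguments.
Unset Strict Implicit.
Unset Printing Implicit Defensive.

Import Order.TTheory GRing.Theory Num.Theory.

Local Open Scope ring_scope.

Definition simple_graph (T : finType) (e : rel T) : Prop :=
  symmetric e /\ irreflexive e.

Definition regular_graph (T : finType) (e : rel T) (k : nat) : Prop :=
  forall x : T, #|[set y | e x y]| = k.

Definition adjmx (R : realType) (T : finType) (e : rel T) : 'M[R]_#|T| :=
  \matrix_(i, j) (e (enum_val i) (enum_val j))%:R.

(* [s] lists the eigenvalues of [A], with algebraic multiplicity, in
   nonincreasing order; comparing degrees gives [size s = n]. *)
Definition ordered_eigenvalues (R : realType) (n : nat) (A : 'M[R]_n)
    (s : seq R) : Prop :=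
  sorted (fun x y => y <= x) s /\ char_poly A = \prod_(x <- s) ('X - x%:P).

(* Indexing starts at 0, so [s`_1] is the second largest eigenvalue and
   [s`_n.-1] the smallest.  When [n = 1] there is no second eigenvalue and
   [s`_1] is the default value 0, which puts no extra constraint on [lam]. *)
Definition nkl_graph (R : realType) (T : finType) (e : rel T)
    (n k : nat) (lam : R) : Prop :=
  [/\ simple_graph e, #|T| = n, (0 < n)%N, regular_graph e k &
      exists2 s : seq R, ordered_eigenvalues (adjmx R e) s &
        Num.max `|s`_1| `|s`_n.-1| <= lam].

Definition between (T : finType) (e : rel T) (A B : {set T}) : rel T :=
  fun x y => e x y && ((x \in A) && (y \in B) || (x \in B) && (y \in A)).

(* [between e A B] relates only vertices of [A :|: B], so [connect] never
   leaves that set. *)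
Definition between_connected (T : finType) (e : rel T) (A B : {set T}) : Prop :=
  {in A :|: B &, forall x y, connect (between e A B) x y}.

Definition indexed_partition (T : finType) (d : nat) (V : 'I_d -> {set T}) :
    Prop :=
  [/\ forall i, V i != set0,
      forall i j, i != j -> [disjoint V i & V j] &
      \bigcup_(i < d) V i = [set: T]].

Definition strong_rigid_partition (T : finType) (e : rel T) (d : nat)
    (V : 'I_d -> {set T}) : Prop :=
  indexed_partition V /\
  forall i j : 'I_d, (i <= j)%N -> between_connected e (V i) (V j).

(* Main.v *)
Require Import Defs.
From mathcomp Require Import all_boot all_order all_algebra.
From mathcomp Require Import spectral sesquilinear complex ring lra.
From mathcomp Require Import reals sequences exp.

Set Implicit Arguments.
Unset Strict Implicit.
Unset Printing Implicit Defensive.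

Import Order.TTheory GRing.Theory Num.Theory.
Local Open Scope ring_scope.

(**
  By the Lovász local lemma and Chernoff's bound, the vertices can be coloured
  with [d] colours so that every vertex has at least [k / (4 d)] neighbours of
  each colour.  Let [V] and [W] be colour classes (possibly equal) and suppose
  that [G[V, W]] splits into two nonempty parts [A] and [B] with no edge
  between them.  By the degree condition there are many edges between [A :&: V]
  and [A :&: W], so the expander mixing lemma forces
  [|A :&: V| |A :&: W| > (n / (9 d))^2], and likewise for [B].  There is no edge
  between [A :&: V] and [B :&: W], nor between [B :&: V] and [A :&: W], so the
  mixing lemma also gives [|A :&: V| |B :&: W| <= (n / (9 d))^2] and
  [|B :&: V| |A :&: W| <= (n / (9 d))^2].  Multiplying gives a contradiction.
*)

(** * The local lemma for functions between finite types *)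

Section LocalLemma.
Variables (T D : finType).
Implicit Types (E F : {set {ffun T -> D}}) (A : {set T}).

(** Events are sets of functions under the uniform measure, with probabilities cleared of
    denominators into cardinalities. This is measurability with respect to the coordinates in
    [A]. *)
Definition determined_by E A :=
  forall f g : {ffun T -> D}, {in A, f =1 g} -> (f \in E) = (g \in E).

(* Exchanging the coordinates in [A] of two functions maps [(E :&: F) * setT]
   bijectively onto [E * F]. *)
Lemma card_setI_independent E F A :
  determined_by E A -> determined_by F (~: A) ->
  (#|E :&: F| * #|{ffun T -> D}| = #|E| * #|F|)%N.
Proof.
move=> dE dF.
pose mix (f g : {ffun T -> D}) := [ffun x => if x \in A then f x else g x].
pose swap (p : {ffun T -> D} * {ffun T -> D}) := (mix p.1 p.2, mix p.2 p.1).
have swapK : involutive swap.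
  move=> [f g]; congr pair; apply/ffunP => x; rewrite !ffunE /=;
    by case: (x \in A).
rewrite -cardsT -!cardsX -(on_card_preimset (f := swap)); last first.
  by exists swap => x _; apply: swapK.
congr #|pred_of_set _|; apply/setP => -[f g]; rewrite !inE /= andbT.
congr andb.
  by apply: dE => x xA; rewrite ffunE xA.
by apply: dF => x; rewrite inE ffunE => /negbTE ->.
Qed.

Variables (R : realFieldType) (I : finType).
Variables (E : I -> {set {ffun T -> D}}) (A : I -> {set T}).

Definition avoiding (S : {set I}) := [set f | [forall i in S, f \notin E i]].

Lemma avoidingP (S : {set I}) f :
  reflect {in S, forall i, f \notin E i} (f \in avoiding S).
Proof. by rewrite inE; apply: forall_inP. Qed.

Lemma avoidingS (S1 S2 : {set I}) :
  S1 \subset S2 -> avoiding S2 \subset avoiding S1.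
Proof.
move=> S12; apply/subsetP => f /avoidingP fS.
by apply/avoidingP => i /(subsetP S12)/fS.
Qed.

Lemma avoiding_setU1 i (S : {set I}) :
  avoiding (i |: S) = avoiding S :\: E i.
Proof.
apply/setP => f; rewrite in_setD; apply/avoidingP/andP.
  move=> fS; split; first by apply: fS; rewrite setU11.
  by apply/avoidingP => j jS; apply: fS; rewrite setU1r.
by move=> [fi /avoidingP fS] j /setU1P[->//|/fS].
Qed.

Variables (p : R) (k : nat).
Hypothesis E_determined : forall i, determined_by (E i) (A i).
Hypothesis E_small : forall i, #|E i|%:R <= p * #|{ffun T -> D}|%:R.
Hypothesis few_neighbors :
  forall i, (#|[set j | ~~ [disjoint A i & A j]]| <= k)%N.
Hypothesis k_gt0 : (0 < k)%N.
Hypothesis p_ge0 : 0 <= p.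
Hypothesis pk_le : 4 * p * k%:R <= 1.
Hypothesis D_gt0 : (0 < #|D|)%N.

Let Omega_gt0 : (0 < #|{ffun T -> D}|)%N.
Proof. by rewrite card_ffun expn_gt0 D_gt0. Qed.

(* Induction on [#|S|]: the conditions in [far] are independent of [E i], while
   by induction those in [near] are violated on at most half of
   [avoiding far]. *)
Lemma card_bad_avoiding (S : {set I}) i : i \notin S ->
  #|E i :&: avoiding S|%:R <= 2 * p * #|avoiding S|%:R.
Proof.
have [n] := ubnP #|S|; elim: n S i => // n IHn S i ltSn iS.
pose N := [set j | ~~ [disjoint A i & A j]].
pose far := S :\: N; pose near := S :&: N.
have indep : #|E i :&: avoiding far|%:R <= p * #|avoiding far|%:R.
  have O0 : 0 < #|{ffun T -> D}|%:R :> R by rewrite ltr0n.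
  rewrite -(ler_pM2r O0) -natrM (@card_setI_independent _ _ (A i)) //.
    by rewrite natrM mulrAC ler_wpM2r.
  move=> f g fg.
  have E_eq j : j \in far -> (f \in E j) = (g \in E j).
    rewrite !inE negbK => /andP[dij _]; apply: E_determined => x xj.
    rewrite fg // inE; apply: contraTN dij => xi.
    by apply/pred0Pn; exists x; rewrite /= xi.
  apply/avoidingP/avoidingP => H j jf; first by rewrite -E_eq ?H.
  by rewrite E_eq ?H.
have far_le : #|avoiding far|%:R <= 2 * #|avoiding S|%:R :> R.
  have [near0|/set0Pn[j0 j0n]] := eqVneq near set0.
    have -> : far = S by rewrite /far -(setID S N) -/near near0 set0U setDDl setUid.
    by rewrite ler_peMl // ler1n.
  (* As [near] is nonempty, [far] is smaller than [S], so the induction hypothesis applies to [far]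
     and each event in [near]. *)
  have ltfar : (#|far| < n)%N.
    apply: leq_trans (ltSn : (#|S| <= n)%N); rewrite -(cardsID N S) -/near -/far.
    by rewrite -[X in (X < _)%N]add0n ltn_add2r; apply/card_gt0P; exists j0.
  have cover : avoiding far \subset
      avoiding S :|: \bigcup_(j in near) (E j :&: avoiding far).
    apply/subsetP => f ff; rewrite inE; case: (boolP (f \in avoiding S)) => //=.
    rewrite inE negb_forall_in => /exists_inP[j jS]; rewrite negbK => fj.
    apply/bigcupP; exists j; last by rewrite inE fj.
    rewrite inE jS; apply: contraLR fj => jN.
    by move/avoidingP: ff; apply; rewrite inE jN.
  have sum_le : #|\bigcup_(j in near) (E j :&: avoiding far)|%:R
      <= \sum_(j in near) #|E j :&: avoiding far|%:R :> R.
    elim/big_rec2: _ => [|j x B _ IH]; first by rewrite cards0.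
    apply: le_trans (lerD (lexx _) IH); rewrite -natrD ler_nat.
    by rewrite cardsU leq_subr.
  have sum_le2 : \sum_(j in near) #|E j :&: avoiding far|%:R
      <= k%:R * (2 * p * #|avoiding far|%:R).
    apply: (@le_trans _ _ (\sum_(j in near) (2 * p * #|avoiding far|%:R))).
      apply: ler_sum => j jn; apply: IHn => //.
      by move: jn; rewrite !inE => /andP[_ ->].
    rewrite sumr_const -[_ *+ #|_|]mulr_natl ler_wpM2r ?mulr_ge0 // ler_nat.
    by apply: leq_trans (few_neighbors i); apply/subset_leq_card/subsetIr.
  have {}cover : #|avoiding far|%:R <= #|avoiding S|%:R
      + #|\bigcup_(j in near) (E j :&: avoiding far)|%:R :> R.
    rewrite -natrD ler_nat; apply: leq_trans (subset_leq_card cover) _.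
    by rewrite cardsU leq_subr.
  (* With [x] for [avoiding far] and [y] for [avoiding S], the bounds give x <= y + 2 p k x <= y + x
     / 2, hence x <= 2 y. *)
  have f0 : 0 <= #|avoiding far|%:R :> R by [].
  have := ler_wpM2r f0 pk_le.
  move: (#|avoiding far|%:R) (#|avoiding S|%:R) cover sum_le sum_le2 {f0 indep} => x y.
  by set z := _%:R; set w := \sum_(_ in _) _ => *; nra.
apply: (le_trans (y := #|E i :&: avoiding far|%:R)).
  by rewrite ler_nat; apply/subset_leq_card/setIS/avoidingS/subsetDl.
apply: le_trans indep _; rewrite [2 * p]mulrC -mulrA.
by rewrite ler_wpM2l.
Qed.

(** Conditions are imposed one at a time. Each new one removes at most a fraction 2 p <= 1/2 of the
    functions still allowed, so some function always survives. *)
Lemma local_lemma : exists f : {ffun T -> D}, forall i, f \notin E i.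
Proof.
have p_le : 4 * p <= 1.
  apply: le_trans pk_le; rewrite ler_peMr ?mulr_ge0 //.
  by rewrite ler1n.
suff /card_gt0P[f /avoidingP fS] : (0 < #|avoiding [set: I]|)%N.
  by exists f => i; apply: fS.
have [n] := ubnP #|[set: I]|; elim: n [set: I] => // n IHn S.
have [->|/set0Pn[i iS]] := eqVneq S set0.
  move=> _; suff -> : avoiding set0 = setT by rewrite cardsT.
  by apply/setP => f; rewrite in_setT; apply/avoidingP => i; rewrite inE.
rewrite (cardsD1 i) iS => /IHn; rewrite -{2}(setD1K iS) avoiding_setU1.
have := card_bad_avoiding (negbT (setD11 i S)).
rewrite -[in X in _ <= X -> _](cardsID (E i)) setIC natrD lt0n.
move=> bad; have := cardsID (E i) (avoiding (S :\ i)).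
set x := #|_ :&: _| in bad *; set y := #|_ :\: _| in bad * => <- xy.
(* If no function survived, then x <= 2 p x <= x / 2 would force x = 0, although x + y > 0. *)
rewrite lt0n; apply: contraNneq xy => y0; move: bad.
have: 0 <= x%:R :> R by [].
rewrite y0 addn0 addr0 -(eqr_nat R) => x0 bad.
by apply/eqP; nra.
Qed.

End LocalLemma.

(** * Balanced colourings of regular graphs *)

(** The power of [t] is a product over the points of [T], so the sum over all functions factors: a
    point of [N] contributes |D| - 1 + t, any other point |D|. *)
Lemma sum_expr_color_count (R : comPzRingType) (T D : finType) (N : {set T})
    (c : D) (t : R) :
  \sum_(f : {ffun T -> D}) t ^+ #|[set x in N | f x == c]| =
  (#|D|%:R - 1 + t) ^+ #|N| * #|D|%:R ^+ #|~: N|.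
Proof.
pose F x y := if (x \in N) && (y == c) then t else 1.
transitivity (\sum_(f : {ffun T -> D}) \prod_x F x (f x)).
  apply: eq_bigr => f _; rewrite -big_mkcond /= prodr_const.
  by congr (_ ^+ _); apply: eq_card => x; rewrite inE.
rewrite -bigA_distr_bigA (bigID (mem N)) /=; congr (_ * _).
  rewrite (eq_bigr (fun=> #|D|%:R - 1 + t)) ?prodr_const // => x xN.
  rewrite (bigD1 c) //= /F xN eqxx addrC; congr (_ + _).
  rewrite (eq_bigr (fun=> 1)) => [|y /negbTE ->//].
  rewrite sumr_const (cardD1 c D) inE /= add1n.
  rewrite -[X in _ = X - 1]natr1 addrK; congr _%:R.
  by apply: eq_card => y; rewrite !inE andbT.
rewrite (eq_bigr (fun=> #|D|%:R)) => [|x /negbTE xN].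
  by rewrite prodr_const; congr (_ ^+ _); apply: eq_card => x; rewrite !inE.
rewrite (eq_bigr (fun=> 1)) ?sumr_const // => y _.
by rewrite /F xN.
Qed.

(* Chernoff's bound, with the exponential moment taken at [-1]. *)
Lemma card_few_color (R : realType) (T D : finType) (N : {set T}) (c : D)
    (a : R) :
  #|[set f : {ffun T -> D} | #|[set x in N | f x == c]|%:R < a]|%:R <=
  expR (a - #|N|%:R / (2 * #|D|%:R)) * #|{ffun T -> D}|%:R.
Proof.
have D0 : 0 < #|D|%:R :> R by rewrite ltr0n; apply/card_gt0P; exists c.
set B := [set f | _]; pose t : R := expR (- 1).
have t_le : t <= 1 / 2.
  rewrite /t expRN -[leRHS]invf_div ?lef_pV2 ?posrE ?expR_gt0 //; last lra.
  by rewrite divr1; apply: le_trans (expR_ge1Dx 1); lra.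
(* Markov's inequality: each function in [B] has count below [a], so its term is at least exp (-
   a). *)
have markov : #|B|%:R * expR (- a) <=
    \sum_(f : {ffun T -> D}) t ^+ #|[set x in N | f x == c]|.
  rewrite mulr_natl -sumr_const [leRHS](bigID (mem B)) /=.
  apply: ler_wpDr; first by apply: sumr_ge0 => f _; rewrite exprn_ge0 ?expR_ge0.
  apply: ler_sum => f; rewrite inE => fa.
  by rewrite /t -expRM_natl mulrN1 ler_expR lerN2 ltW.
(* Since t <= 1/2, the left side is at most |D| (1 - 1 / (2 |D|)). *)
have base : #|D|%:R - 1 + t <= #|D|%:R * expR (- (2 * #|D|%:R)^-1).
  apply: le_trans (ler_wpM2l (ltW D0) (expR_ge1Dx _)).
  rewrite mulrDr mulr1 mulrN invfM mulrCA divff ?gt_eqF // mulr1.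
  lra.
have base0 : 0 <= #|D|%:R - 1 + t.
  by rewrite addr_ge0 ?expR_ge0 // subr_ge0 ler1n -(ltr0n R).
rewrite expRD -mulrA [leRHS]mulrC -ler_pdivrMr ?expR_gt0 // -expRN.
apply: le_trans markov _; rewrite sum_expr_color_count.
apply: le_trans (ler_wpM2r _ (lerXn2r #|N| _ _ base)) _.
- by rewrite exprn_ge0 // ltW.
- by rewrite nnegrE.
- by rewrite nnegrE mulr_ge0 ?expR_ge0 // ltW.
rewrite exprMn mulrAC -exprD cardsC card_ffun natrX mulrC.
by rewrite -expRM_natl mulrN.
Qed.

(** The quartic term y^4 / 24 of the series suffices once y^2 >= 24 * 256 = 6144, and 80^2 =
    6400. *)
Lemma expR_ge_sqr (R : realType) (y : R) : 80 <= y -> 256 * y ^+ 2 <= expR y.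
Proof.
move=> y80; have y0 : 0 <= y by lra.
apply: le_trans (expR_ge1Dxn 3 y0).
have -> : 4`! = 24%N by [].
rewrite (exprM y 2 2).
have : 6400 <= y ^+ 2 by nra.
by move: (y ^+ 2) => z z_ge; nra.
Qed.

(** With y = k / (8 d), the exponential is exp (- 2 y) and 4 k^2 d = d^3 * 256 y^2. One factor exp y
    absorbs d^3, as y >= 160 ln d; the other absorbs 256 y^2, as ln d >= 1/2 gives y >= 80. This
    fixes the constant 1280 = 8 * 160. *)
Lemma local_lemma_numeric (R : realType) (d k : nat) : (1 < d)%N ->
  1280 * d%:R * ln (d%:R : R) <= k%:R ->
  4 * expR (- (k%:R / (4 * d%:R) : R)) * (k * k * d)%:R <= 1.
Proof.
move=> d1 hk; have d2 : 2 <= d%:R :> R by rewrite (ler_nat R 2).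
have ln2 : 1 / 2 <= ln (d%:R : R).
  apply: le_trans (_ : ln 2 <= _); last by rewrite ler_ln ?posrE //; lra.
  have := @le_ln1Dx R (- (1 / 2)); rewrite -(_ : 2^-1 = 1 - 1 / 2); last by field.
  by rewrite lnV ?posrE //; lra.
pose y : R := k%:R / (8 * d%:R).
have kE : k%:R = 8 * d%:R * y :> R by rewrite /y; field; lra.
have lny : 160 * ln (d%:R : R) <= y by nra.
have dexp : d%:R ^+ 3 <= expR y.
  have e : expR (ln (d%:R : R)) = d%:R by rewrite lnK // posrE; lra.
  by rewrite -[X in X ^+ 3]e -expRM_natl ler_expR; lra.
have yexp := @expR_ge_sqr R y ltac:(lra).
have -> : k%:R / (4 * d%:R) = y + y by rewrite /y; field; lra.
rewrite !natrM kE expRN expRD mulrAC ler_pdivrMr ?mulr_gt0 ?expR_gt0 // mul1r.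
have -> : 4 * (8 * d%:R * y * (8 * d%:R * y) * d%:R) =
  d%:R ^+ 3 * (256 * y ^+ 2) by ring.
by apply: ler_pM => //; rewrite ?exprn_ge0 // mulr_ge0 ?sqr_ge0.
Qed.

(** The bad event for (v, c) is that [v] has fewer than k / (4 d) neighbours of colour [c], a
    quarter of the mean. Chernoff's bound gives it probability at most exp (k / (4 d) - k / (2 d)) =
    exp (- k / (4 d)). *)
Lemma balanced_coloring (R : realType) (T : finType) (e : rel T) (d k : nat) :
  (1 < d)%N -> (0 < k)%N -> symmetric e -> regular_graph e k ->
  1280 * d%:R * ln (d%:R : R) <= k%:R ->
  exists f : {ffun T -> 'I_d}, forall v c,
    k%:R / (4 * d%:R) <= #|[set x | e v x & f x == c]|%:R :> R.
Proof.
move=> d1 k0 esym kreg hk.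
pose N v := [set x | e v x]; pose a : R := k%:R / (4 * d%:R).
pose E (i : T * 'I_d) :=
  [set f : {ffun T -> 'I_d} | #|[set x in N i.1 | f x == i.2]|%:R < a].
have dR : 0 < d%:R :> R by rewrite ltr0n ltnW.
have [| | | | | | |f fE] := @local_lemma T 'I_d R (T * 'I_d)%type E (fun i => N i.1)
  (expR (- a)) (k * k * d).
- move=> [v c] f g fg; rewrite !inE; congr (_%:R < _).
  by apply: eq_card => x; rewrite !inE; case: (boolP (e v x)) => //= vx;
    rewrite fg ?inE.
- move=> [v c]; apply: le_trans (card_few_color _ _ _) _.
  rewrite /= kreg card_ord; have -> // : a - k%:R / (2 * d%:R) = - a.
  by rewrite /a; field; lra.
- move=> [v c].
  (* A neighbourhood meeting that of [v] belongs to an endpoint of a walk of length two from [v]: at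
     most k^2 vertices, each with d colours. *)
  pose W := \bigcup_(u in N v) N u.
  apply: (@leq_trans #|setX W [set: 'I_d]|).
    apply/subset_leq_card/subsetP => -[w c']; rewrite !inE andbT /=.
    case/pred0Pn => u /= /andP[]; rewrite !inE => vu wu.
    by apply/bigcupP; exists u; rewrite inE // esym.
  rewrite cardsX cardsT card_ord leq_mul2r; apply/orP; right.
  have <- : (\sum_(u in N v) k = k * k)%N by rewrite sum_nat_const kreg.
  rewrite /W; elim/big_rec2: _ => [|u s B _ IH]; first by rewrite cards0.
  by rewrite cardsU kreg (leq_trans (leq_subr _ _)) // leq_add2l.
- by rewrite !muln_gt0 k0 ltnW.
- exact: expR_ge0.
- exact: local_lemma_numeric.
- by rewrite card_ord ltnW.
exists f => v c; have := fE (v, c); rewrite inE -leNgt /=.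
by congr (_ <= _%:R); apply: eq_card => x; rewrite !inE.
Qed.

(** * The expander mixing lemma *)

Lemma sum_enum_val (V : nmodType) (T : finType) (F : T -> V) :
  \sum_(i < #|T|) F (enum_val i) = \sum_x F x.
Proof. by rewrite [RHS](reindex _ (onW_bij _ (@enum_val_bij T))). Qed.

Lemma char_poly_conj (F : fieldType) n (P M : 'M[F]_n) : P \in unitmx ->
  char_poly (invmx P *m M *m P) = char_poly M.
Proof.
move=> Pu; rewrite /char_poly /char_poly_mx.
have PV : map_mx polyC (invmx P) *m map_mx polyC P = 1%:M.
  by rewrite -map_mxM mulVmx // map_mx1.
have -> : 'X%:M - map_mx polyC (invmx P *m M *m P) =
    map_mx polyC (invmx P) *m ('X%:M - map_mx polyC M) *m map_mx polyC P.
  by rewrite mulmxBr mulmxBl !map_mxM mul_mx_scalar -scalemxAl PV scalemx1.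
by rewrite !det_mulmx mulrAC -det_mulmx PV det1 mul1r.
Qed.

Section SpectralBound.
Local Open Scope sesquilinear_scope.
Variable C : numClosedFieldType.

(** In the orthonormal basis given by [P] the form is diagonal, and the weighted inequality 2 a b <=
    t a^2 + b^2 / t applies to each term. The free weight [t] replaces the square roots of a
    Cauchy-Schwarz bound. *)
Lemma unitary_diag_bound n (P : 'M[C]_n) (D x y : 'rV[C]_n) (l t : C) :
  P \is unitarymx -> 0 < t -> (forall i, `|D 0 i| <= l) ->
  2 * `|(x *m (P^t* *m diag_mx D *m P) *m y^t*) 0 0| <=
  l * (t * (x *m x^t*) 0 0 + t^-1 * (y *m y^t*) 0 0).
Proof.
move=> Pu t0 Dl; have PVP : P^t* *m P = 1%:M.
  by rewrite -invmx_unitary // mulVmx // unitarymx_unit.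
pose u := x *m P^t*; pose w := y *m P^t*.
have adj z : (z *m P^t*)^t* = P *m z^t* by rewrite trmx_mul map_mxM trmxCK.
have norm_coord z : (z *m z^t*) 0 0 = \sum_i `|(z *m P^t*) 0 i| ^+ 2.
  have <- : (z *m P^t*) *m (z *m P^t*)^t* = z *m z^t*.
    by rewrite adj mulmxA -(mulmxA z) PVP mulmx1.
  by rewrite mxE; apply: eq_bigr => i _; rewrite !mxE normCK.
have -> : x *m (P^t* *m diag_mx D *m P) *m y^t* = u *m diag_mx D *m w^t*.
  by rewrite /w adj /u !mulmxA.
rewrite !norm_coord -/u -/w; clearbody u w; rewrite mxE !mulr_sumr -big_split /= mulr_sumr.
apply: le_trans (ler_wpM2l _ (ler_norm_sum _ _ _)) _ => //.
rewrite mulr_sumr; apply: ler_sum => i _.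
rewrite mul_mx_diag !mxE !normrM norm_conjC.
set a := `|u 0 i|; set b := `|w 0 i|; set c := `|D 0 i|.
have a0 : 0 <= a := normr_ge0 _.
have b0 : 0 <= b := normr_ge0 _.
have amgm : 2 * (a * b) <= t * a ^+ 2 + t^-1 * b ^+ 2.
  rewrite -subr_ge0.
  have -> : t * a ^+ 2 + t^-1 * b ^+ 2 - 2 * (a * b) = t^-1 * (t * a - b) ^+ 2.
    by field; rewrite gt_eqF.
  (* In a complex field a square is nonnegative only if its base is shown to be real. *)
  rewrite mulr_ge0 ?invr_ge0 ?(ltW t0) // real_exprn_even_ge0 //.
  by rewrite rpredB // ?rpredM // ger0_real // ltW.
have -> : 2 * (a * c * b) = c * (2 * (a * b)) by ring.
have c0 : 0 <= c := normr_ge0 _.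
have cl : c <= l := Dl i.
by apply: ler_pM => //; rewrite mulr_ge0 ?mulr_ge0.
Qed.

Variables (T : finType) (e : rel T) (k : nat).
Hypotheses (e_sym : symmetric e) (e_reg : regular_graph e k).

Let n := #|T|.
Let A : 'M[C]_n := \matrix_(i, j) (e (enum_val i) (enum_val j))%:R.
Let ind (S : {set T}) : 'rV[C]_n := \row_i (enum_val i \in S)%:R.

(** Ordered pairs are counted, so an edge inside [S :&: U] counts twice, in agreement with the
    bilinear form of the adjacency matrix. *)
Definition edge_count (S U : {set T}) := (\sum_(x in S) #|[set y in U | e x y]|)%N.

Lemma indicator_mul_adjacency S U :
  (ind S *m A *m (ind U)^t*) 0 0 = (edge_count S U)%:R.
Proof.
rewrite -mulmxA mxE.
under eq_bigr => i _.
  rewrite !mxE.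
  under eq_bigr => j _ do rewrite !mxE conjC_nat.
  rewrite (sum_enum_val (fun y => (e (enum_val i) y)%:R * (y \in U)%:R)).
  over.
rewrite (sum_enum_val (fun x => (x \in S)%:R *
  \sum_y (e x y)%:R * (y \in U)%:R)) natr_sum [RHS]big_mkcond /=.
apply: eq_bigr => x _; case: (x \in S); rewrite ?mul0r // mul1r.
rewrite -sum1_card natr_sum [RHS]big_mkcond /=.
by apply: eq_bigr => y _; rewrite inE; case: (y \in U); case: (e x y);
  rewrite ?mulr0 ?mulr1 ?mul0r.
Qed.

Lemma indicator_mulC S U : (ind S *m (ind U)^t*) 0 0 = #|S :&: U|%:R.
Proof.
rewrite mxE; under eq_bigr => i _ do rewrite !mxE conjC_nat.
rewrite (sum_enum_val (fun y => (y \in S)%:R * (y \in U)%:R)).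
rewrite -sum1_card natr_sum [RHS]big_mkcond /=.
by apply: eq_bigr => y _; rewrite inE; case: (y \in U); case: (y \in S);
  rewrite ?mulr0 ?mulr1 ?mul0r.
Qed.

(** Normality is what the spectral theorem asks for in order to diagonalise [A] by a unitary
    matrix. *)
Lemma adjacency_normal : A \is normalmx.
Proof.
apply: symmetric_normalmx.
  apply/is_hermitianmxP; rewrite expr0 scale1r map_mx_id //.
  by apply/matrixP => i j; rewrite !mxE e_sym.
by apply/mxOverP => i j; rewrite mxE realn.
Qed.

Lemma indicator_eigen : ind setT *m A = k%:R *: ind setT.
Proof.
apply/rowP => j; rewrite !mxE in_setT mulr1.
under eq_bigr => i _ do rewrite !mxE in_setT mul1r.
rewrite (sum_enum_val (fun x => (e x (enum_val j))%:R)).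
rewrite -(e_reg (enum_val j)) -sum1_card natr_sum [RHS]big_mkcond /=.
by apply: eq_bigr => y _; rewrite inE e_sym; case: (e _ y).
Qed.

Variables (s : seq C) (l : C).
Hypothesis A_char : char_poly A = \prod_(x <- s) ('X - x%:P).
Hypothesis k_simple : count_mem k%:R s = 1%N.
Hypothesis s_small : forall x, x \in s -> x != k%:R -> `|x| <= l.
Hypothesis l_ge0 : 0 <= l.

Lemma mixing_closed S U (t : C) : 0 < t ->
  2 * `|(edge_count S U)%:R - k%:R / n%:R * (#|S|%:R * #|U|%:R)| <=
  l * (t * #|S|%:R + t^-1 * #|U|%:R).
Proof.
move=> t0; pose P := spectralmx A; pose D := spectral_diag A.
have Pu : P \is unitarymx := spectral_unitarymx A.
have AE : A = P^t* *m diag_mx D *m P.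
  by rewrite -invmx_unitary //; apply/orthomx_spectralP/adjacency_normal.
have PVP : P^t* *m P = 1%:M.
  by rewrite -invmx_unitary // mulVmx // unitarymx_unit.
(* Both lists are the roots of the characteristic polynomial with multiplicity, so the hypotheses on
   [s] transfer to the diagonal [D]. *)
have D_perm : perm_eq [seq D 0 i | i <- enum 'I_n] s.
  apply: prod_XsubC_eq; rewrite -A_char AE -invmx_unitary //.
  rewrite char_poly_conj ?unitarymx_unit //.
  rewrite char_poly_trig ?diag_mx_is_trig // big_map big_enum /=.
  by apply: eq_bigr => i _; rewrite mxE eqxx mulr1n.
have Dk : #|[set i | D 0 i == k%:R]| = 1%N.
  apply: etrans k_simple; rewrite -(permP D_perm) count_map -sum1_count big_enum_cond /=.
  by rewrite sum1dep_card.
have /cards1P[i0 Di0] : #|[set i | D 0 i == k%:R]| == 1%N by apply/eqP.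
have Dk_eq i : (D 0 i == k%:R) = (i == i0).
  by move/setP: Di0 => /(_ i); rewrite !inE.
(* The all-ones vector in the eigenbasis. As an eigenvector for the simple eigenvalue [k], it is
   supported on [i0]; its squared norm being n, that coordinate has squared modulus n. *)
pose u := ind setT *m P^t*.
have uD i : u 0 i * D 0 i = k%:R * u 0 i.
  have : u *m diag_mx D = k%:R *: u.
    rewrite /u scalemxAl -indicator_eigen AE -!mulmxA.
    by rewrite (unitarymxP Pu) mulmx1.
  by rewrite mul_mx_diag => /rowP /(_ i); rewrite !mxE.
have u0 i : i != i0 -> u 0 i = 0.
  move=> ii0; apply/eqP; move: (uD i) => /eqP.
  rewrite mulrC -subr_eq0 -mulrBl mulf_eq0 subr_eq0 Dk_eq (negbTE ii0) //.
have uu : u 0 i0 * (u 0 i0)^* = n%:R.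
  have : (u *m u^t*) 0 0 = n%:R.
    rewrite /u trmx_mul map_mxM trmxCK mulmxA -(mulmxA (ind _)) PVP mulmx1.
    by rewrite indicator_mulC setIT cardsT.
  rewrite mxE (bigD1 i0) //= big1 => [|i /u0 ->]; last by rewrite mul0r.
  by rewrite addr0 !mxE.
have n0 : n%:R != 0 :> C.
  by rewrite pnatr_eq0 -lt0n /n (leq_trans _ (ltn_ord i0)).
pose q : C := k%:R / n%:R.
(* Subtracting [q J], where [J] is the all-ones matrix, replaces the eigenvalue
   [k] by 0 and leaves the other ones unchanged. *)
pose D' : 'rV[C]_n := \row_i (if i == i0 then 0 else D 0 i).
have A'E : A - q *: ((ind setT)^t* *m ind setT) = P^t* *m diag_mx D' *m P.
  have -> : ind setT = u *m P by rewrite /u -mulmxA PVP mulmx1.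
  clearbody u.
  have -> : (u *m P)^t* *m (u *m P) = P^t* *m (u^t* *m u) *m P.
    by rewrite trmx_mul map_mxM !mulmxA.
  rewrite AE scalemxAl scalemxAr -mulmxBl -mulmxBr.
  congr (_ *m _ *m _); apply/matrixP => i j; rewrite !mxE big_ord1 !mxE.
  have [->|ij] := eqVneq i j; last first.
    rewrite !mulr0n sub0r; have [ii0|/u0 ->] := eqVneq i i0.
      by rewrite (u0 j) ?mulr0 ?oppr0 // -ii0 eq_sym.
    by rewrite conjC0 mul0r mulr0 oppr0.
  have [->|ji0] := eqVneq j i0.
    rewrite [_^* * _]mulrC uu divfK // !mulr1n.
    by have := Dk_eq i0; rewrite eqxx => /eqP ->; rewrite subrr.
  by rewrite u0 // mulr0 mulr0 subr0.
have D'l i : `|D' 0 i| <= l.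
  rewrite mxE; case: eqVneq => [|ii0]; first by rewrite normr0.
  apply: s_small; last by rewrite Dk_eq.
  by rewrite -(perm_mem D_perm); apply: map_f; rewrite mem_enum.
have := unitary_diag_bound (ind S) (ind U) Pu t0 D'l.
rewrite !indicator_mulC !setIid -A'E mulmxBr mulmxBl.
rewrite -scalemxAr -scalemxAl mulmxA -(mulmxA _ (ind setT)).
have E0 : forall (a b : 'M[C]_1), (a - q *: b) 0 0 = a 0 0 - q * b 0 0.
  by move=> a b; rewrite !mxE.
rewrite E0 indicator_mul_adjacency [X in q * X]mxE big_ord1 !indicator_mulC.
by rewrite setIT setTI.
Qed.

End SpectralBound.

(** By monotonicity every entry after the first lies between the last entry and the second one. *)
Lemma tail_eigenvalue_bound (R : realType) (s : seq R) (lam x : R) :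
  sorted (fun x y => y <= x) s -> Num.max `|s`_1| `|s`_(size s).-1| <= lam ->
  x \in behead s -> `|x| <= lam.
Proof.
move=> s_sorted; rewrite ge_max => /andP[]; rewrite !ler_norml.
move=> /andP[_ s1] /andP[sn _] /(nthP 0)[j]; rewrite size_behead nth_behead.
case: s s_sorted s1 sn => // y s /= s_sorted s1 sn js <-.
have mono := @sorted_leq_nth _ (fun x y : R => y <= x) _ _ 0 (y :: s) s_sorted.
have {}mono : forall i1 i2, (i1 <= i2 <= size s)%N ->
    (y :: s)`_i2 <= (y :: s)`_i1.
  move=> i1 i2 /andP[i12 i2s]; apply: mono => //.
  - by move=> a b c ab bc; apply: le_trans bc ab.
  - by rewrite inE /= ltnS (leq_trans i12).
apply/andP; split.
  by apply: le_trans sn _; apply: (mono j.+1); rewrite js leqnn.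
by apply: le_trans s1; apply: (mono 1%N j.+1).
Qed.

Local Notation rc := (real_complex _).

(** The spectral argument runs over [R[i]]; both sides of the resulting inequality are images of
    reals, so it descends to [R]. *)
Lemma expander_mixing (R : realType) (T : finType) (e : rel T) (n k : nat)
    (lam t : R) (S U : {set T}) :
  nkl_graph e n k lam -> lam < k%:R -> 0 < t ->
  2 * `|(edge_count e S U)%:R - k%:R / n%:R * (#|S|%:R * #|U|%:R)| <=
  lam * (t * #|S|%:R + t^-1 * #|U|%:R).
Proof.
move=> [[e_sym _] cardT n0 e_reg [s [s_sorted s_char] s_lam]] lam_k t0.
have lam0 : 0 <= lam.
  by apply: le_trans s_lam; rewrite le_max normr_ge0.
have size_s : size s = n.
  apply/eqP; rewrite -eqSS -(size_prod_XsubC s id) -s_char size_char_poly.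
  by rewrite cardT.
rewrite -size_s in s_lam.
have s_tail := tail_eigenvalue_bound s_sorted s_lam.
pose A := \matrix_(i < #|T|, j < #|T|) (e (enum_val i) (enum_val j))%:R : 'M[R[i]]_#|T|.
have A_char : char_poly A = \prod_(x <- map rc s) ('X - x%:P).
  have -> : A = map_mx rc (adjmx R e).
    by apply/matrixP => i j; rewrite !mxE rmorph_nat.
  rewrite -map_char_poly s_char big_map rmorph_prod /=.
  by apply: eq_bigr => x _; rewrite rmorphB /= map_polyX map_polyC.
(* The all-ones vector is an eigenvector for [k], nonzero because the graph has a vertex. *)
have k_s : k%:R \in s.
  have : root (char_poly A) k%:R.
    rewrite -eigenvalue_root_char; apply/eigenvalueP.
    exists (\row_i (enum_val i \in [set: T])%:R).
      exact: (indicator_eigen _ e_sym e_reg).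
    apply/eqP => /rowP; rewrite -cardT in n0 *.
    move=> /(_ (Ordinal n0)); rewrite !mxE in_setT => /eqP.
    by rewrite oner_eq0.
  rewrite A_char root_prod_XsubC -(rmorph_nat rc) mem_map //.
  exact: complexI.
(* As [lam < k], the eigenvalue [k] can only be the first one, and is simple. *)
have k_tail : k%:R \notin behead s.
  by apply/negP => /s_tail; rewrite normr_nat leNgt lam_k.
have k_count : count_mem k%:R (map rc s) = 1%N.
  rewrite count_map (eq_count (a2 := pred1 k%:R)); last first.
    by move=> x; rewrite /= -(rmorph_nat rc) (inj_eq (@complexI R)).
  case: (s) k_s k_tail => // y s' /=; rewrite inE => /predU1P[<-|->//].
  by rewrite eqxx => /count_memPn ->.
have normC_real (x : R) : `|rc x| = rc `|x|.
  by rewrite normc_def /= expr0n /= addr0 sqrtr_sqr.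
have s_small x : x \in map rc s -> x != k%:R -> `|x| <= rc lam.
  case/mapP => y ys -> yk; rewrite normC_real lecR s_tail //.
  case: (s) ys yk k_s k_tail => // z s' /=; rewrite !inE.
  case/predU1P=> [->|//] zk; case/predU1P => [kz|->//].
  by move: zk; rewrite -kz rmorph_nat eqxx.
pose x : R := (edge_count e S U)%:R - k%:R / n%:R * (#|S|%:R * #|U|%:R).
pose y : R := lam * (t * #|S|%:R + t^-1 * #|U|%:R).
rewrite -/x -/y.
have rc_lam0 : 0 <= rc lam by rewrite ler0c.
have rc_t0 : 0 < rc t by rewrite -[0](rmorph0 rc) ltcR.
have := mixing_closed e_sym e_reg A_char k_count s_small rc_lam0 S U rc_t0.
rewrite (_ : _ - _ = rc x); last first.
  by rewrite /x rmorphB !rmorphM fmorphV !rmorph_nat cardT.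
rewrite (_ : _ * (_ + _) = rc y); last first.
  by rewrite /y rmorphM rmorphD !rmorphM fmorphV !rmorph_nat.
rewrite normC_real -[2](rmorph_nat rc) -rmorphM lecR //.
Qed.

Lemma expander_mixing_sqrt (R : realType) (T : finType) (e : rel T) (n k : nat)
    (lam : R) (S U : {set T}) :
  nkl_graph e n k lam -> lam < k%:R -> (0 < #|S|)%N -> (0 < #|U|)%N ->
  `|(edge_count e S U)%:R - k%:R / n%:R * (#|S|%:R * #|U|%:R)| <=
  lam * (Num.sqrt #|S|%:R * Num.sqrt #|U|%:R).
Proof.
move=> G lam_k S0 U0.
pose a : R := Num.sqrt #|S|%:R; pose b : R := Num.sqrt #|U|%:R.
have a0 : 0 < a by rewrite sqrtr_gt0 ltr0n.
have b0 : 0 < b by rewrite sqrtr_gt0 ltr0n.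
(* The weight b / a makes both terms on the right equal to a b. *)
have := @expander_mixing R T e n k lam (b / a) S U G lam_k (divr_gt0 b0 a0).
have -> : b / a * #|S|%:R + (b / a)^-1 * #|U|%:R = 2 * (a * b).
  rewrite -[in #|S|%:R](sqr_sqrtr (ler0n R #|S|)).
  rewrite -[in #|U|%:R](sqr_sqrtr (ler0n R #|U|)) -/a -/b.
  by field; rewrite !gt_eqF.
by rewrite [leRHS]mulrCA ler_pM2l.
Qed.

(** * Connectivity between colour classes *)

Section EdgeCount.
Variables (T : finType) (e : rel T).
Implicit Types S U : {set T}.

Lemma edge_countC S U : symmetric e -> edge_count e S U = edge_count e U S.
Proof.
move=> e_sym; rewrite /edge_count.
have count_sum X Y : (\sum_(x in X) #|[set y in Y | e x y]| =
    \sum_(x in X) \sum_(y in Y) e x y)%N.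
  apply: eq_bigr => x _; rewrite -sum1_card big_mkcond [RHS]big_mkcond /=.
  by apply: eq_bigr => y _; rewrite inE; case: (y \in Y); case: (e x y).
rewrite !count_sum exchange_big /=.
by apply: eq_bigr => y _; apply: eq_bigr => x _; rewrite e_sym.
Qed.

Lemma edge_count_ge (R : numDomainType) (c : R) S U :
  {in S, forall x, c <= #|[set y in U | e x y]|%:R} ->
  c * #|S|%:R <= (edge_count e S U)%:R.
Proof.
move=> deg; rewrite mulr_natr -sumr_const natr_sum.
by apply: ler_sum => x /deg.
Qed.

Lemma edge_count_eq0 S U :
  {in S & U, forall x y, ~~ e x y} -> edge_count e S U = 0%N.
Proof.
move=> noedge; apply: big1 => x xS; apply: eq_card0 => y.
by rewrite !inE; apply/andP => -[yU]; apply/negP/noedge.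
Qed.

End EdgeCount.

Section RigidPartition.
Variables (R : realType) (T : finType) (e : rel T) (n k d : nat) (lam : R).
Hypothesis G : nkl_graph e n k lam.
Hypotheses (k_gt0 : (0 < k)%N) (d_gt0 : (0 < d)%N).
Hypothesis lam_le : 9 * d%:R * lam <= k%:R.
Implicit Types S U V W P : {set T}.

Let e_sym : symmetric e. Proof. by case: G => [[]]. Qed.
Let n0 : 0 < n%:R :> R. Proof. by rewrite ltr0n; case: G. Qed.
Let k0 : 0 < k%:R :> R. Proof. by rewrite ltr0n. Qed.
Let d1 : 1 <= d%:R :> R. Proof. by rewrite ler1n. Qed.
Let lam0 : 0 <= lam.
Proof.
by case: G => [_ _ _ _ [s _]]; apply: le_trans; rewrite le_max normr_ge0.
Qed.
Let lam_lt : lam < k%:R.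
Proof.
have dlam : lam <= d%:R * lam by rewrite ler_peMl.
by move: lam_le k0 lam0; rewrite -mulrA; lra.
Qed.

(** Let a^2 = |S|, b^2 = |U| and c = k / (4 d). The edge count is at least c a^2 and c b^2, hence at
    least c a b. Comparing with the mixing upper bound and dividing by a b gives c <= (k / n) a b +
    lam. *)
Lemma expander_dense_pair S U : (0 < #|S|)%N -> (0 < #|U|)%N ->
  {in S, forall x, k%:R / (4 * d%:R) <= #|[set y in U | e x y]|%:R :> R} ->
  {in U, forall x, k%:R / (4 * d%:R) <= #|[set y in S | e x y]|%:R :> R} ->
  n%:R / (9 * d%:R) < Num.sqrt #|S|%:R * Num.sqrt #|U|%:R :> R.
Proof.
move=> S0 U0 /edge_count_ge degS /edge_count_ge.
rewrite edge_countC // => degU.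
have := expander_mixing_sqrt G lam_lt S0 U0.
rewrite ler_norml => /andP[_]; move: degS degU.
rewrite -(sqr_sqrtr (ler0n R #|S|)) -(sqr_sqrtr (ler0n R #|U|)) !sqrtr_sqr.
rewrite !ger0_norm ?sqrtr_ge0 //.
have a0 : 0 < Num.sqrt #|S|%:R :> R by rewrite sqrtr_gt0 ltr0n.
have b0 : 0 < Num.sqrt #|U|%:R :> R by rewrite sqrtr_gt0 ltr0n.
move: (Num.sqrt _) (Num.sqrt _) (edge_count _ _ _)%:R a0 b0.
move=> a b E a0 b0 Ea Eb mix.
have ab0 : 0 < a * b by rewrite mulr_gt0.
pose c : R := k%:R / (4 * d%:R); rewrite -/c in Ea Eb.
have d0 : 0 < d%:R :> R by rewrite ltr0n.
have c0 : 0 < c by rewrite divr_gt0 ?mulr_gt0.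
have Eab : c * (a * b) <= E.
  have : 0 <= c * (a - b) ^+ 2 by rewrite mulr_ge0 ?sqr_ge0 ?ltW.
  by nra.
have c_le : c <= k%:R / n%:R * (a * b) + lam.
  rewrite -(ler_pM2r ab0); apply: le_trans Eab _.
  by move: mix; rewrite -exprMn lerBlDr; nra.
have lam_d : lam <= k%:R / (9 * d%:R) by rewrite ler_pdivlMr ?mulr_gt0 // mulrC.
(* Here 5/36 = 1/4 - 1/9, which exceeds the required 1/9 = 4/36. *)
have : k%:R * (5 / (36 * d%:R)) <= k%:R * (a * b / n%:R).
  have -> : k%:R * (5 / (36 * d%:R)) = c - k%:R / (9 * d%:R) :> R.
    by rewrite /c; field; lra.
  rewrite mulrA [X in _ <= X]mulrAC.
  by move: c_le lam_d; lra.
rewrite ler_pM2l // ler_pdivlMr // [b * a]mulrC => /(lt_le_trans _); apply.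
have -> : n%:R / (9 * d%:R) = 1 / (9 * d%:R) * n%:R :> R by field; lra.
rewrite ltr_pM2r //.
have -> : 5 / (36 * d%:R) = 1 / (9 * d%:R) + 1 / (36 * d%:R) :> R.
  by field; lra.
by rewrite ltrDl divr_gt0 // mulr_gt0.
Qed.

(** With edge count 0 the mixing lemma reads (k / n) a^2 b^2 <= lam a b, so a b <= lam n / k <= n /
    (9 d). Empty sets are treated apart, since the mixing bound assumes both sets nonempty. *)
Lemma expander_sparse_pair S U : {in S & U, forall x y, ~~ e x y} ->
  Num.sqrt #|S|%:R * Num.sqrt #|U|%:R <= n%:R / (9 * d%:R) :> R.
Proof.
move=> /edge_count_eq0 noedge.
have q0 : 0 <= n%:R / (9 * d%:R) :> R.
  by rewrite divr_ge0 ?mulr_ge0 //.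
have [S0|S0] := posnP #|S|; first by rewrite S0 sqrtr0 mul0r.
have [U0|U0] := posnP #|U|; first by rewrite U0 sqrtr0 mulr0.
have := expander_mixing_sqrt G lam_lt S0 U0.
rewrite noedge sub0r normrN ger0_norm ?mulr_ge0 ?invr_ge0 //.
have a0 : 0 < Num.sqrt #|S|%:R :> R by rewrite sqrtr_gt0 ltr0n.
have b0 : 0 < Num.sqrt #|U|%:R :> R by rewrite sqrtr_gt0 ltr0n.
rewrite -{1}(sqr_sqrtr (ler0n R #|S|)) -{1}(sqr_sqrtr (ler0n R #|U|)).
have := mulr_gt0 a0 b0; rewrite -exprMn.
move: (_ * Num.sqrt _) => ab ab0; rewrite expr2 mulrA ler_pM2r // => h.
have d0 : 0 < d%:R :> R by rewrite ltr0n.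
rewrite ler_pdivlMr ?mulr_gt0 // -(ler_pM2l k0).
have h' : k%:R * ab <= lam * n%:R by rewrite -ler_pdivrMr // mulrAC.
have : k%:R * ab * (9 * d%:R) <= lam * n%:R * (9 * d%:R).
  by rewrite ler_pM2r ?mulr_gt0.
rewrite -mulrA => /le_trans; apply.
have -> : lam * n%:R * (9 * d%:R) = 9 * d%:R * lam * n%:R by ring.
by rewrite ler_pM2r.
Qed.

Let dense_in V :=
  forall v, k%:R / (4 * d%:R) <= #|[set x | e v x & x \in V]|%:R :> R.

Lemma dense_in_neighbor V v : dense_in V -> exists2 w, e v w & w \in V.
Proof.
move=> /(_ v) deg.
have : 0 < #|[set x | e v x & x \in V]|%:R :> R.
  by apply: lt_le_trans deg; rewrite divr_gt0 ?mulr_gt0 // ltr0n.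
rewrite ltr0n => /card_gt0P[w]; rewrite inE => /andP[vw wV].
by exists w.
Qed.

(** Closure keeps in [P] all [W]-neighbours of a vertex of [P :&: V], and symmetrically, so the
    degree condition passes to the pair [P :&: V], [P :&: W]. Only closure is asked of [P], so that
    the complement of a component also qualifies. *)
Lemma component_large V W P : dense_in V -> dense_in W ->
  (forall z w, z \in P -> between e V W z w -> w \in P) ->
  (exists2 z, z \in P & z \in V :|: W) ->
  n%:R / (9 * d%:R) <
    Num.sqrt #|P :&: V|%:R * Num.sqrt #|P :&: W|%:R :> R.
Proof.
move=> dV dW P_closed [z zP zVW].
have closedVW x y : x \in P -> x \in V -> y \in W -> e x y -> y \in P.
  by move=> xP xV yW xy; apply: (P_closed x) => //; rewrite /between xy xV yW.
have closedWV x y : x \in P -> x \in W -> y \in V -> e x y -> y \in P.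
  move=> xP xW yV xy; apply: (P_closed x) => //.
  by rewrite /between xy xW yV orbT.
(* A vertex of [P] in one class has a neighbour in the other class, which closure puts in [P]. *)
have [V0 W0] : (0 < #|P :&: V|)%N /\ (0 < #|P :&: W|)%N.
  case/setUP: zVW => zX.
    have [w zw wW] := dense_in_neighbor z dW.
    split; apply/card_gt0P; [exists z | exists w]; rewrite inE ?zP //.
    by rewrite (closedVW z).
  have [w zw wV] := dense_in_neighbor z dV.
  split; apply/card_gt0P; [exists w | exists z]; rewrite inE ?zP //.
  by rewrite (closedWV z).
apply: expander_dense_pair => // x /setIP[xP xX].
  apply: le_trans (dW x) _; rewrite ler_nat; apply/subset_leq_card/subsetP => y.
  by rewrite !inE => /andP[xy yW]; rewrite xy yW (closedVW x).
apply: le_trans (dV x) _; rewrite ler_nat; apply/subset_leq_card/subsetP => y.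
by rewrite !inE => /andP[xy yV]; rewrite xy yV (closedWV x).
Qed.

Lemma dense_between_connected V W :
  dense_in V -> dense_in W -> between_connected e V W.
Proof.
move=> dV dW x y xVW yVW; apply/negP => xy.
pose A := [set z | connect (between e V W) x z].
have between_sym z w : between e V W z w = between e V W w z.
  by rewrite /between e_sym orbC [(w \in V) && _]andbC [(w \in W) && _]andbC.
have A_closed z w : z \in A -> between e V W z w -> w \in A.
  by rewrite !inE => xz zw; apply: connect_trans xz (connect1 zw).
have B_closed z w : z \in ~: A -> between e V W z w -> w \in ~: A.
  move=> zB zw; rewrite in_setC; apply: contraTN zB => wA.
  by rewrite in_setC negbK (A_closed w) // between_sym.
have A_large : n%:R / (9 * d%:R) <
    Num.sqrt #|A :&: V|%:R * Num.sqrt #|A :&: W|%:R :> R.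
  by apply: component_large => //; exists x; rewrite // inE connect0.
have B_large : n%:R / (9 * d%:R) <
    Num.sqrt #|~: A :&: V|%:R * Num.sqrt #|~: A :&: W|%:R :> R.
  by apply: component_large => //; exists y; rewrite // !inE; apply/negP.
have AB : {in A :&: V & ~: A :&: W, forall z w, ~~ e z w}.
  move=> z w /setIP[zA zV] /setIP[]; rewrite in_setC => wB wW.
  apply: contra wB => zw; apply: (A_closed z) => //.
  by rewrite /between zw zV wW.
have BA : {in ~: A :&: V & A :&: W, forall z w, ~~ e z w}.
  move=> z w /setIP[]; rewrite in_setC => zB zV /setIP[wA wW].
  apply: contra zB => zw; apply: (A_closed w) => //.
  by rewrite between_sym /between zw zV wW.
have := expander_sparse_pair AB; have := expander_sparse_pair BA.
have c0 : 0 <= n%:R / (9 * d%:R) :> R by rewrite divr_ge0 ?mulr_ge0.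
move: A_large B_large (sqrtr_ge0 (#|A :&: V|%:R : R)) (sqrtr_ge0 (#|~: A :&: V|%:R : R))
  (sqrtr_ge0 (#|A :&: W|%:R : R)) (sqrtr_ge0 (#|~: A :&: W|%:R : R)).
move: (n%:R / _) c0 (Num.sqrt _) (Num.sqrt _) (Num.sqrt _) (Num.sqrt _).
move=> c c0 b' b a' a aa' bb' a0 b0 a'0 b'0 ba' ab'.
(* The two lower bounds and the two upper bounds multiply to the same product of four square
   roots. *)
have lt1 : c * c < (a * a') * (b * b') by rewrite ltr_pM.
have : (b * a') * (a * b') <= c * c by rewrite ler_pM // mulr_ge0.
rewrite leNgt => /negP; apply; apply: lt_le_trans lt1 _.
by rewrite le_eqVlt; apply/orP; left; apply/eqP; ring.
Qed.

Lemma coloring_rigid_partition (f : {ffun T -> 'I_d}) :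
  (forall v c, k%:R / (4 * d%:R) <=
     #|[set x | e v x & f x == c]|%:R :> R) ->
  strong_rigid_partition e (fun i => [set x | f x == i]).
Proof.
move=> f_deg; have dense i : dense_in [set x | f x == i].
  move=> v; apply: le_trans (f_deg v i) _; rewrite ler_nat.
  by apply/subset_leq_card/subsetP => x; rewrite !inE.
split; last by move=> i j _; apply: dense_between_connected.
split.
- move=> i; have [_ cardT n_gt0 _ _] := G.
  have /card_gt0P[v _] : (0 < #|T|)%N by rewrite cardT.
  by have [w _ wi] := dense_in_neighbor v (dense i); apply/set0Pn; exists w.
- move=> i j ij; apply/pred0Pn => -[x /= /andP[]]; rewrite !inE => /eqP -> /eqP.
  by apply/eqP.
- apply/setP => x; rewrite in_setT; apply/bigcupP; exists (f x) => //.
  by rewrite inE.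
Qed.

End RigidPartition.

Theorem theorem1p7 (R : realType) :
  exists C : R, 1 < C /\
    forall (d : nat), (0 < d)%N ->
    forall (T : finType) (e : rel T) (n k : nat) (lam : R),
      nkl_graph e n k lam ->
      (0 < k)%N ->
      Num.max (9 * d%:R * lam) (C * d%:R * ln (d%:R : R)) <= k%:R ->
      exists V : 'I_d -> {set T}, strong_rigid_partition e V.
Proof.
exists 1280; split; first by rewrite ltr1n.
move=> d d_gt0 T e n k lam G k_gt0; rewrite ge_max => /andP[lam_le log_le].
suff [f f_deg] : exists f : {ffun T -> 'I_d}, forall v c,
    k%:R / (4 * d%:R) <= #|[set x | e v x & f x == c]|%:R :> R.
  exists (fun i => [set x | f x == i]).
  exact: (coloring_rigid_partition G k_gt0 d_gt0 lam_le f_deg).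
have [[e_sym _] _ _ e_reg _] := G.
case: d d_gt0 {lam_le} log_le => [//|[|d]] _ log_le; last first.
  exact: balanced_coloring log_le.
exists [ffun=> ord0] => v c; rewrite mulr1.
have -> : [set x | e v x & [ffun=> ord0] x == c] = [set x | e v x].
  by apply/setP => x; rewrite !inE !ord1 eqxx andbT.
by rewrite e_reg ler_pdivrMr // ler_peMr // ler1n.
Qed.
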